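(* Let $G$ be a graph on $n$ vertices that contains no cycle of length five as a subgraph and contains no induced copy of the cycle $C_4$ of length four. Then $$|E(G)| \le (1+o(1))\frac{n^{3/2}}{2\sqrt[10]{2}},$$ where $o(1)$ denotes a quantity tending to $0$ as $n\to\infty$.
   Context: A graph is induced-$C_4$-free if there are no four vertices $x,y,z,w$ such that $xy,yz,zw,wx$ are edges while $xz$ and $yw$ are not edges. *)

(* Defs.v *)
From mathcomp Require Import all_boot.

Set Implicit Arguments.
Unset Strict Implicit.
Unset Printing Implicit Defensive.

Record sgraph (T : finType) := SGraph {
  adj : rel T;
  adj_sym : symmetric adj;
  adj_irrefl : irreflexive adj
}.

Definition edges (T : finType) (G : sgraph T) : {set {set T}} :=
  [set [set x; y] | x in T, y in T & adj G x y].

(* [k >= 3] is intended: [ucycle] degenerates for lists of length at most 2. *)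
Definition cycle_free (k : nat) (T : finType) (G : sgraph T) : Prop :=
  ~ exists c : seq T, size c = k /\ ucycle (adj G) c.

(* Distinctness is required explicitly because irreflexivity makes
   [~~ adj G x z] true when [x = z]. *)
Definition induced_C4_free (T : finType) (G : sgraph T) : Prop :=
  ~ exists x y z w : T,
      [/\ uniq [:: x; y; z; w],
          [&& adj G x y, adj G y z, adj G z w & adj G w x],
          ~~ adj G x z & ~~ adj G y w].

(* Main.v *)
Require Import Defs.
From mathcomp Require Import all_boot all_order all_algebra.
From mathcomp Require Import all_classical all_reals all_analysis.
From mathcomp Require Import ring lra zify.
Import Order.TTheory GRing.Theory Num.Theory.
Import numFieldNormedType.Exports.

(** Let [D = 2 |E(G)|], let [W] be the number of walks of length three, and let
    [S u] be the set of vertices at distance exactly two from [u].  Since [G]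
    has no [C_5], for an edge [uv] the sets [S u] and [S v] meet only inside the
    neighbourhoods of the common neighbours of [u] and [v], so summing
    [|S u| + |S v| <= n + |S u :&: S v|] over all edges bounds
    [\sum_u deg u * |S u|] by [D n / 2 + O(n^2)].

    Conversely [|S u|] is the number of paths of length two leaving [u], up to
    [O(deg u)], minus the number of vertices of [S u] that are reached twice.
    As [G] has no induced [C_4], such a vertex is adjacent to both ends of an
    edge [ab] inside the neighbourhood of [u].  An edge [ab] lying in at least
    three triangles is the only edge of each of these triangles that lies in
    more than one triangle.  Hence the loss [deg u * codeg a b], which is at
    most [deg u * deg a] and at most [deg u * deg b], can be charged to the
    edges [ua] and [ub], each charged once, and the total loss is at most
    [W / 4 + O(n^2)].  Thus [3/4 W <= D n / 2 + O(n^2)], and [W >= D^3 / n^2]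
    gives [|E(G)| <= (1 + o(1)) n^(3/2) / sqrt 6], which is stronger than
    required since [2 * 2^(1/10) < sqrt 6]. *)

Set Implicit Arguments.
Unset Strict Implicit.
Unset Printing Implicit Defensive.

(** * A three-term arithmetic-geometric mean inequality *)

Section AGM.
Local Open Scope ring_scope.

(** The three terms have product 1. With [m = x * y] and [s = x + y], clearing denominators leaves
    [3 * m <= m ^+ 2 + s]. *)
Lemma agm3 (F : realFieldType) (x y : F) : 0 < x -> 0 < y ->
  3 <= x * y + x^-1 + y^-1.
Proof.
move=> x0 y0.
have : 3 * (x * y) <= (x * y) ^+ 2 + x + y.
  have [h|h] := lerP (9 / 4) (x + y).
    by have := sqr_ge0 (x * y - 3 / 2); nra.
  set s := x + y in h *; set m := x * y.
  have s0 : 0 < s by rewrite addr_gt0.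
  have m0 : m <= s ^+ 2 / 4 by have := sqr_ge0 (x - y); rewrite /s /m; nra.
  rewrite -addrA -/s; move: s m s0 h m0 => s m s0 h m0.
  have m1 : s ^+ 2 / 4 <= 3 / 2 by nra.
  (* [m ^+ 2 - 3 * m] decreases below [3 / 2], so [m = s ^+ 2 / 4] is the worst case; there the
     claim is the next product, up to a factor 16. *)
  have : 0 <= (s ^+ 2 / 4 - m) * (3 - m - s ^+ 2 / 4) by apply: mulr_ge0; lra.
  have : 0 <= s * (s - 2) ^+ 2 * (s + 4).
    by apply: mulr_ge0; [apply: mulr_ge0; [lra|exact: sqr_ge0]|lra].
  nra.
have xy0 : 0 < x * y by rewrite mulr_gt0.
move=> h; rewrite -(ler_pM2r xy0); apply: le_trans h _.
suff -> : (x * y + x^-1 + y^-1) * (x * y) = (x * y) ^+ 2 + x + y by [].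
by field; rewrite !gt_eqF.
Qed.

End AGM.

(** * Degrees, codegrees and walks of length three *)

Section Counting.

Variables (T : finType) (G : sgraph T).
Local Open Scope nat_scope.

Local Notation "x ~~> y" := (nat_of_bool (adj G x y)) (at level 30).

Definition deg (x : T) : nat := \sum_y x ~~> y.
Definition codeg (x y : T) : nat := \sum_z x ~~> z * y ~~> z.
Definition degsum : nat := \sum_u deg u.
Definition degsq : nat := \sum_u deg u * deg u.
Definition walks3 : nat := \sum_u \sum_v u ~~> v * (deg u * deg v).
Definition dist2 (u : T) : {pred T} :=
  [pred w | [&& w != u, ~~ adj G u w & 0 < codeg u w]].

Lemma adjC x y : adj G x y = adj G y x. Proof. exact: adj_sym. Qed.

Lemma adj_neq x y : adj G x y -> x != y.
Proof. by apply: contraTneq => ->; rewrite adj_irrefl. Qed.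

Lemma codegC x y : codeg x y = codeg y x.
Proof. by apply: eq_bigr => z _; rewrite mulnC. Qed.

Lemma codegE x y : codeg x y = #|[set z | adj G x z && adj G y z]|.
Proof.
rewrite -sum1_card big_mkcond; apply: eq_bigr => z _ /=.
by rewrite inE; case: (adj G x z); case: (adj G y z).
Qed.

Lemma codeg_gt0 x y : 0 < codeg x y -> exists2 z, adj G x z & adj G y z.
Proof.
by rewrite codegE => /card_gt0P [z]; rewrite inE => /andP [] *; exists z.
Qed.

Lemma codeg_gt2 x y p q : 2 < codeg x y ->
  exists z, [/\ adj G x z, adj G y z, z != p & z != q].
Proof.
rewrite codegE => h; set A := finset _ in h.
have /card_gt0P [z] : 0 < #|A :\ p :\ q|.
  by move: h; rewrite (cardsD1 p A) (cardsD1 q (A :\ p)); lia.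
by rewrite !inE => /and3P [? ?] /andP [] *; exists z.
Qed.

Lemma leq_codeg_deg x y : codeg x y <= deg x.
Proof. by apply: leq_sum => z _; case: (adj G x z); case: (adj G y z). Qed.

Lemma codeg_diag x : codeg x x = deg x.
Proof. by apply: eq_bigr => z _; case: (adj G x z). Qed.

Lemma deg_le x : deg x <= #|T|.
Proof. by rewrite -sum1_card; apply: leq_sum => y _; case: (adj G x y). Qed.

Lemma degsum_le : degsum <= #|T| ^ 2.
Proof.
apply: (@leq_trans (\sum_(u : T) #|T|)).
  by apply: leq_sum => u _; exact: deg_le.
by rewrite sum_nat_const -mulnn.
Qed.

Lemma edges_le_degsum : 2 * #|edges G| <= degsum.
Proof.
have -> : degsum = \sum_(p : T * T | adj G p.1 p.2) 1.
  rewrite /degsum /deg pair_bigA [RHS]big_mkcond.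
  by apply: eq_bigr => p _ /=; case: (adj G _ _).
rewrite (partition_big (fun p => [set p.1; p.2]) (mem (edges G))) /=; last first.
  by move=> [x y] /= xy; apply/imset2P; exists x y; rewrite ?inE.
rewrite mulnC -sum_nat_const; apply: leq_sum => e /imset2P [x y _].
rewrite inE => /= xy ->.
have nxy := adj_neq xy.
rewrite (bigD1 (x, y)) ?xy ?eqxx //= (bigD1 (y, x)) //=.
by rewrite adjC xy finset.setUC eqxx xpair_eqE negb_and eq_sym nxy.
Qed.

Lemma adj_deg_gt0 x y : adj G x y -> 0 < deg x.
Proof. by move=> xy; rewrite /deg (bigD1 y) //= xy. Qed.

(* With [x] and [y] the degrees of the ends of an edge divided by the average
   degree, summing [agm3] over all edges leaves only the walks on the right. *)
Lemma walks3_ge : degsum ^ 3 <= #|T| ^ 2 * walks3.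
Proof.
have [->//|D0] := posnP degsum.
have n0 : 0 < #|T| by have := degsum_le; case: #|T| D0 => //; lia.
have nq : (0 < #|T|%:R :> rat)%R by rewrite ltr0n.
have dq : (0 < degsum%:R :> rat)%R by rewrite ltr0n.
pose c : rat := (degsum%:R / #|T|%:R)%R.
have c0 : (0 < c)%R by rewrite divr_gt0.
pose r (x : T) : rat := (c / (deg x)%:R)%R.
have pw : (\sum_u \sum_v ((u ~~> v)%:R * 3 : rat) <=
    \sum_u \sum_v ((u ~~> v * (deg u * deg v))%:R * (c ^+ 2)^-1
      + (u ~~> v)%:R * r u + (u ~~> v)%:R * r v))%R.
  apply: ler_sum => u _; apply: ler_sum => v _.
  case uv: (adj G u v); last by rewrite !mul0r !addr0.
  have du := adj_deg_gt0 uv.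
  have dv : 0 < deg v by rewrite adjC in uv; exact: adj_deg_gt0 uv.
  have := @agm3 rat ((deg u)%:R / c) ((deg v)%:R / c).
  rewrite !divr_gt0 ?ltr0n // => /(_ isT isT) /le_trans; apply.
  rewrite !mul1r mul1n natrM (invf_div (deg u)%:R c) (invf_div (deg v)%:R c).
  by rewrite mulf_div -expr2.
(* A row sums to [c], or to 0 at an isolated vertex, hence only an inequality. *)
have rowsum : (\sum_u \sum_v (u ~~> v)%:R * r u <= degsum%:R :> rat)%R.
  have -> : (degsum%:R = \sum_(u : T) c :> rat)%R.
    by rewrite sumr_const -[RHS]mulr_natr /c divfK // gt_eqF.
  apply: ler_sum => u _; rewrite -big_distrl -natr_sum /= -/(deg u) /r.
  have [->|du] := posnP (deg u); first by rewrite mul0r ltW.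
  by rewrite mulrC divfK // pnatr_eq0 -lt0n.
have colsum : (\sum_u \sum_v (u ~~> v)%:R * r v <= degsum%:R :> rat)%R.
  rewrite exchange_big; apply: le_trans rowsum; apply: ler_sum => u _ /=.
  by apply: ler_sum => v _; rewrite adjC.
have E1 : (\sum_u \sum_v (u ~~> v)%:R * 3 = degsum%:R * 3 :> rat)%R.
  rewrite natr_sum big_distrl; apply: eq_bigr => u _ /=.
  by rewrite -big_distrl natr_sum.
have E2 : (\sum_u \sum_v (u ~~> v * (deg u * deg v))%:R * (c ^+ 2)^-1
    = walks3%:R * (c ^+ 2)^-1 :> rat)%R.
  rewrite natr_sum big_distrl; apply: eq_bigr => u _ /=.
  by rewrite -big_distrl natr_sum.
move: pw; under [X in (_ <= X)%R -> _]eq_bigr => u _ do rewrite !big_split /=.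
rewrite !big_split /= E1 E2 => pw.
have {pw} : (degsum%:R <= walks3%:R * (c ^+ 2)^-1 :> rat)%R by lra.
rewrite ler_pdivlMr ?exprn_gt0 // /c expr_div_n mulrA ler_pdivrMr ?exprn_gt0 //.
by rewrite -exprS -!natrX -natrM ler_nat mulnC.
Qed.

(** * Local structure forced by the excluded cycles *)

Hypothesis C5 : cycle_free 5 G.
Hypothesis C4 : induced_C4_free G.

Lemma no_C5 x y z v w : uniq [:: x; y; z; v; w] ->
  adj G x y -> adj G y z -> adj G z v -> adj G v w -> adj G w x -> False.
Proof.
move=> U xy yz zv vw wx; apply: C5; exists [:: x; y; z; v; w]; split=> //.
by rewrite /ucycle U andbT /= xy yz zv vw wx.
Qed.

Lemma common_nbrs_adj u v a b : u != v -> ~~ adj G u v -> a != b ->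
  adj G u a -> adj G v a -> adj G u b -> adj G v b -> adj G a b.
Proof.
move=> nuv Nuv nab ua va ub vb; apply/negPn/negP => Nab.
apply: C4; exists u, a, v, b; split=> //; last first.
  by rewrite ua (adjC a) va vb adjC ub.
by rewrite /= !inE !negb_or nuv nab !adj_neq // adjC.
Qed.

(** Of three common neighbours [x], [y], [z], the last two are adjacent, closing the five-cycle
    [u x v y z]. *)
Lemma codeg_nonadj_le2 u v : u != v -> ~~ adj G u v -> codeg u v <= 2.
Proof.
move=> nuv Nuv; rewrite leqNgt; apply/negP => h.
have [x [ux vx _ _]] := codeg_gt2 u u h.
have [y [uy vy nyx _]] := codeg_gt2 x u h.
have [z [uz vz nzx nzy]] := codeg_gt2 x y h.
have yz : adj G y z by apply: (common_nbrs_adj nuv) => //; rewrite eq_sym.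
apply: (@no_C5 u x v y z) => //; try by rewrite adjC.
by rewrite /= !inE !negb_or nuv (eq_sym x y) nyx (eq_sym x z) nzx (eq_sym y z) nzy
  !adj_neq // adjC.
Qed.

Lemma triangle_small_codeg u a b : adj G u a -> adj G u b -> adj G a b ->
  (codeg u a <= 2) || (codeg u b <= 2).
Proof.
move=> ua ub ab; rewrite (leqNgt (codeg u a)) (leqNgt (codeg u b)).
rewrite -negb_and; apply/negP => /andP [ha hb].
have [c [uc ac ncb _]] := codeg_gt2 b b ha.
have [d [ud bd nda ndc]] := codeg_gt2 a c hb.
apply: (@no_C5 u c a b d) => //; try by rewrite adjC.
by rewrite /= !inE !negb_or ncb (eq_sym c d) ndc (eq_sym a d) nda
  !adj_neq // adjC.
Qed.

(** A third common neighbour [v] of [a] and [b] would close the five-cycle [v b u c a]. *)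
Lemma book_page u a b c : adj G u a -> adj G u b -> adj G a b ->
  2 < codeg a b -> adj G u c -> adj G a c -> c = b.
Proof.
move=> ua ub ab h uc ac; apply/eqP/negPn/negP => ncb.
have [v [av bv nvu nvc]] := codeg_gt2 u c h.
apply: (@no_C5 v b u c a) => //; try by rewrite adjC.
by rewrite /= !inE !negb_or nvu nvc (eq_sym b c) ncb !adj_neq // adjC.
Qed.

(** * Weighted triangle counts *)

Definition tri u a b : nat := u ~~> a * (u ~~> b * a ~~> b).

Lemma sum_tri u a : \sum_b tri u a b = u ~~> a * codeg u a.
Proof. by rewrite -big_distrr. Qed.

Lemma tri_swap u a b : tri u a b = tri u b a.
Proof. by rewrite /tri (adjC a b) mulnCA. Qed.

Lemma tri_rot u a b : tri u a b = tri a u b.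
Proof. by rewrite /tri (adjC a u) [X in _ * X]mulnC. Qed.

(** Each triangle [u a b] is charged to an end [a] or [b] whose codegree with [u] is at most 2; the
    two choices of end give the other factor 2. *)
Lemma sum_codeg_nbrs u : \sum_a u ~~> a * codeg u a <= 4 * deg u.
Proof.
pose s a : nat := codeg u a <= 2.
have le1 : \sum_a u ~~> a * codeg u a
    <= \sum_a \sum_b (s a * tri u a b + s b * tri u a b).
  under eq_bigr => a _ do rewrite -sum_tri.
  apply: leq_sum => a _; apply: leq_sum => b _; rewrite -mulnDl /tri /s.
  case ua: (adj G u a) => //; case ub: (adj G u b) => //.
  case ab: (adj G a b) => //.
  by have /orP [->|->] := triangle_small_codeg ua ub ab; rewrite ?addn1.
have le2 : \sum_a \sum_b s a * tri u a b <= 2 * deg u.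
  rewrite big_distrr /=; apply: leq_sum => a _.
  rewrite -big_distrr /= sum_tri /s.
  by case: leqP => h; case: (adj G u a); lia.
apply: leq_trans le1 _; under eq_bigr => a _ do rewrite big_split /=.
rewrite big_split /= [X in _ + X]exchange_big /=.
under [X in _ + X]eq_bigr => a _ do under eq_bigr => b _ do rewrite tri_swap.
by move: le2; lia.
Qed.

Lemma sum_tri_le (f : T -> nat) :
  \sum_u \sum_a \sum_b tri u a b * f u <= 4 * \sum_u deg u * f u.
Proof.
rewrite big_distrr /=; apply: leq_sum => u _.
under eq_bigr => a _ do rewrite -big_distrl /= sum_tri.
by rewrite -big_distrl /= mulnA leq_mul2r sum_codeg_nbrs orbT.
Qed.

(** Sum [codeg a b] over all pairs: for fixed [a], the diagonal gives [deg a], neighbours at most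
    [4 * deg a], and other vertices at most 2 each. *)
Lemma degsq_le : degsq <= 7 * #|T| ^ 2.
Proof.
have -> : degsq = \sum_a \sum_b codeg a b.
  rewrite /degsq /codeg; under [RHS]eq_bigr => a _ do rewrite exchange_big.
  rewrite [RHS]exchange_big; apply: eq_bigr => u _ /=.
  rewrite /deg big_distrl; apply: eq_bigr => a _ /=.
  by rewrite big_distrr; apply: eq_bigr => b _ /=; rewrite adjC (adjC u b).
apply: (@leq_trans (\sum_a (deg a * 5 + #|T| * 2))).
  apply: leq_sum => a _.
  apply: (@leq_trans (\sum_b ((b == a) * deg a + a ~~> b * codeg a b + 2))).
    apply: leq_sum => b _; have [->|nab] := eqVneq b a.
      by rewrite codeg_diag mul1n -addnA leq_addr.
    case ab: (adj G a b); first by rewrite mul0n mul1n leq_addr.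
    by apply: codeg_nonadj_le2; rewrite ?ab // eq_sym.
  rewrite !big_split /= sum_nat_const leq_add // (mulnSr _ 4) mulnC addnC.
  rewrite leq_add ?sum_codeg_nbrs //.
  by rewrite -big_distrl /= (bigD1 a) //= eqxx big1 ?mul1n // => b /negPf ->.
rewrite big_split /= sum_nat_const -big_distrl /= -/degsum.
have := degsum_le; rewrite -mulnn -[#|xpredT|]/#|T|; nia.
Qed.

(** Symmetrized in [u] and [a], each edge [ua] is charged at most once: by [book_page] the third
    vertex [b] is unique, and [ab], [ub] cannot both have codegree above 2. *)
Lemma sum_book_le :
  2 * \sum_u \sum_a \sum_b (2 < codeg a b) * tri u a b * (deg u * deg a)
    <= walks3.
Proof.
rewrite mul2n -addnn {2}exchange_big -big_split; apply: leq_sum => u _ /=.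
rewrite -big_split; apply: leq_sum => a _ /=.
rewrite -big_split /=.
under eq_bigr => b _ do rewrite tri_rot (mulnC (deg a)) -mulnDl -mulnDl.
rewrite -big_distrl leq_mul2r; apply/orP; right.
case ua: (adj G u a); last first.
  by rewrite big1 // => b _; rewrite /tri (adjC a u) ua muln0.
have [/existsP [b /andP [tb hb]]|/existsPn N] :=
  boolP [exists b, (0 < tri a u b) && ((2 < codeg a b) || (2 < codeg u b))];
  last first.
  rewrite big1 // => b _; have := N b.
  rewrite negb_and negb_or; case: tri => [|m] /=; rewrite ?muln0 //.
  by move=> /andP [/negPf -> /negPf ->].
have {tb} [ub ab] : adj G u b /\ adj G a b.
  by move: tb; rewrite /tri; case: (adj G a b); case: (adj G u b); rewrite ?muln0.
have au : adj G a u by rewrite adjC.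
have page c : adj G u c -> adj G a c -> c = b.
  by case/orP: hb => h uc ac; [apply: (book_page ua)|apply: (book_page au)].
rewrite (bigD1 b) //= big1 ?addn0 => [|c ncb]; last first.
  rewrite /tri; case uc: (adj G u c); last by rewrite ?muln0.
  case ac: (adj G a c); last by rewrite ?muln0.
  by rewrite (page c) ?eqxx in ncb.
rewrite /tri au ab ub !muln1.
have [h|_] := ltnP 2 (codeg a b); have [h'|_] := ltnP 2 (codeg u b) => //.
have := triangle_small_codeg (u := b) (a := a) (b := u).
rewrite !(adjC b) !(codegC b) au ub ab (leqNgt (codeg a b)).
by rewrite (leqNgt (codeg u b)) h h' => /(_ isT isT isT).
Qed.

(** * Vertices at distance two and the walk inequality *)

Lemma sum_nbr_deg u : \sum_w codeg u w = \sum_a u ~~> a * deg a.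
Proof.
rewrite exchange_big; apply: eq_bigr => a _ /=.
by rewrite -big_distrr; congr (_ * _); apply: eq_bigr => w _; rewrite adjC.
Qed.

(* Bonferroni: a vertex [w] at distance two from [u] is counted by [codeg u w]
   neighbours [a] of [u], and any two of them are adjacent. *)
Lemma card_dist2_ge u :
  2 * \sum_a u ~~> a * deg a
    <= 2 * #|dist2 u| + 10 * deg u + \sum_a \sum_b tri u a b * codeg a b.
Proof.
pose pairs w := \sum_a \sum_b tri u a b * (a ~~> w * b ~~> w).
have -> : \sum_a \sum_b tri u a b * codeg a b = \sum_w pairs w.
  rewrite /pairs [RHS]exchange_big; apply: eq_bigr => a _ /=.
  rewrite [RHS]exchange_big; apply: eq_bigr => b _ /=.
  by rewrite -big_distrr.
have le1 : \sum_w codeg u w * 2 <= \sum_w ((w \in dist2 u) * 2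
    + (u ~~> w * codeg u w) * 2 + (w == u) * (deg u * 2) + pairs w).
  apply: leq_sum => w _; have [->|nwu] := eqVneq w u.
    by rewrite codeg_diag; lia.
  rewrite inE nwu; case uw: (adj G u w); first by lia.
  rewrite /= !mul0n !addn0.
  have sq : codeg u w * codeg u w <= codeg u w + pairs w.
    rewrite {1 2}/codeg big_distrl /= -big_split; apply: leq_sum => a _ /=.
    rewrite big_distrr /=.
    apply: (@leq_trans (\sum_b ((b == a) * (u ~~> a * w ~~> a)
                               + tri u a b * (a ~~> w * b ~~> w)))).
      apply: leq_sum => b _; rewrite /tri ![adj G _ w]adjC.
      case ua: (adj G u a) => //; case ub: (adj G u b) => //;
        case wa: (adj G w a) => //; case wb: (adj G w b) => //.
      have [//|nab] := eqVneq b a.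
      by rewrite (@common_nbrs_adj u w a b) ?uw // eq_sym.
    rewrite big_split leq_add2r -big_distrl /=.
    rewrite (bigD1 a) //= eqxx big1 ?mul1n // => b /negPf -> //.
  (* For [k = codeg u w > 0], [2 * k <= 2 + k * (k - 1)] is [(k - 1) * (k - 2) >= 0]. *)
  case: (codeg u w) sq => [|[|m]] //=; lia.
rewrite -sum_nbr_deg mulnC big_distrl; apply: leq_trans le1 _.
rewrite !big_split leq_add2r -!big_distrl /=.
have -> : \sum_w (w \in dist2 u) = #|dist2 u|.
  by rewrite -sum1_card [RHS]big_mkcond; apply: eq_bigr => w _; case: (w \in _).
have -> : \sum_w (w == u) = 1.
  by rewrite (bigD1 u) //= eqxx big1 // => b /negPf ->.
by have := sum_codeg_nbrs u; lia.
Qed.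

(** If [w] is in both sets via [a] next to [u] and [b] next to [v], then [a = b], or [u a w b v] is
    a five-cycle. *)
Lemma card_dist2_edge u v : adj G u v ->
  #|dist2 u| + #|dist2 v| <= #|T| + \sum_a u ~~> a * v ~~> a * deg a.
Proof.
move=> uv; rewrite -cardUI leq_add ?max_card //.
apply: (@leq_trans (\sum_a u ~~> a * v ~~> a * codeg a a)); last first.
  by apply: leq_sum => a _; rewrite codeg_diag.
rewrite -sum1_card big_mkcond.
under [X in _ <= X]eq_bigr => a _ do rewrite big_distrr /=.
rewrite exchange_big; apply: leq_sum => w _ /=.
case: ifP => //; rewrite !inE => /andP [/and3P [wu Nuw /codeg_gt0 [a ua wa]]].
move=> /and3P [wv Nvw /codeg_gt0 [b vb wb]].
have [ab|nab] := eqVneq a b.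
  by rewrite (bigD1 a) //= ua ab vb (adjC b) wb.
have nav : a != v by apply: contraNneq Nvw => <-; rewrite adjC.
have nbu : b != u by apply: contraNneq Nuw => <-; rewrite adjC.
exfalso; apply: (@no_C5 u a w b v) => //; try by rewrite adjC.
by rewrite /= !inE !negb_or nab nav (eq_sym u b) nbu (eq_sym u w) wu wv
  !adj_neq // adjC.
Qed.

Lemma walks3_le_degsq : 3 * walks3 <= 2 * (degsum * #|T|) + 44 * degsq.
Proof.
pose S := \sum_u deg u * #|dist2 u|.
pose L := \sum_u \sum_a \sum_b tri u a b * (deg u * codeg a b).
have leL : 2 * L <= walks3 + 16 * degsq.
  have := sum_tri_le (fun u => 2 * deg u).
  have -> : \sum_u deg u * (2 * deg u) = 2 * degsq.
    by rewrite big_distrr; apply: eq_bigr => u _; rewrite mulnCA.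
  have := sum_book_le.
  have : L <=
      \sum_u \sum_a \sum_b (2 < codeg a b) * tri u a b * (deg u * deg a)
      + \sum_u \sum_a \sum_b tri u a b * (2 * deg u).
    rewrite -big_split; apply: leq_sum => u _ /=.
    rewrite -big_split; apply: leq_sum => a _ /=.
    rewrite -big_split; apply: leq_sum => b _ /=.
    have [h|h] := ltnP 2 (codeg a b).
      rewrite mul1n -mulnDr leq_mul2l; apply/orP; right.
      by have := leq_codeg_deg a b; nia.
    by rewrite mul0n add0n leq_mul2l [2 * _]mulnC leq_mul2l h !orbT.
  by lia.
have leS : 2 * walks3 <= 2 * S + 10 * degsq + L.
  rewrite /walks3 /S /degsq /L !big_distrr -!big_split; apply: leq_sum => u _ /=.
  have -> : \sum_v u ~~> v * (deg u * deg v) = deg u * \sum_v u ~~> v * deg v.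
    by rewrite big_distrr; apply: eq_bigr => v _; rewrite mulnCA.
  have -> : \sum_a \sum_b tri u a b * (deg u * codeg a b)
      = deg u * \sum_a \sum_b tri u a b * codeg a b.
    rewrite big_distrr; apply: eq_bigr => a _; rewrite big_distrr /=.
    by apply: eq_bigr => b _; rewrite mulnCA.
  by have := card_dist2_ge u; nia.
have leE : 2 * S <= degsum * #|T| + 4 * degsq.
  have -> : 2 * S = \sum_u \sum_v u ~~> v * (#|dist2 u| + #|dist2 v|).
    under eq_bigr => u _ do under eq_bigr => v _ do rewrite mulnDr.
    under eq_bigr => u _ do rewrite big_split /=.
    rewrite big_split /= mul2n -addnn; congr (_ + _).
      by apply: eq_bigr => u _; rewrite -big_distrl.
    rewrite exchange_big; apply: eq_bigr => u _; rewrite -big_distrl /=.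
    by congr (_ * _); apply: eq_bigr => v _; rewrite adjC.
  apply: (@leq_trans
      (\sum_u \sum_v u ~~> v * (#|T| + \sum_a u ~~> a * v ~~> a * deg a))).
    apply: leq_sum => u _; apply: leq_sum => v _; rewrite leq_mul2l.
    by case uv: (adj G u v); rewrite //= card_dist2_edge.
  under eq_bigr => u _ do under eq_bigr => v _ do rewrite mulnDr.
  under eq_bigr => u _ do rewrite big_split /= -big_distrl /=.
  rewrite big_split -big_distrl /= leq_add2l.
  apply: leq_trans (sum_tri_le deg); rewrite [X in _ <= X]exchange_big.
  apply: leq_sum => u _ /=; rewrite [X in _ <= X]exchange_big.
  apply: leq_sum => v _ /=; rewrite big_distrr; apply: leq_sum => a _ /=.
  rewrite /tri (adjC a u) (adjC a v).
  by case: (adj G u v); case: (adj G u a); case: (adj G v a); rewrite ?mul1n.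
by lia.
Qed.

Lemma degsum_cube_le :
  3 * degsum ^ 3 <= 2 * (degsum * #|T| ^ 3) + 308 * #|T| ^ 4.
Proof.
apply: (@leq_trans (#|T| ^ 2 * (3 * walks3))).
  by rewrite mulnCA leq_mul2l walks3_ge.
apply: (@leq_trans (#|T| ^ 2 * (2 * (degsum * #|T|) + 308 * #|T| ^ 2))).
  rewrite leq_mul2l; apply/orP; right.
  by have := walks3_le_degsq; have := degsq_le; lia.
by apply: eq_leq; ring.
Qed.

End Counting.

(** * The asymptotic bound *)

Local Open Scope classical_set_scope.
Local Open Scope ring_scope.

Theorem theorem3 (R : realType) :
  exists o : nat -> R,
    o n @[n --> \oo] --> (0 : R) /\
    forall (n : nat) (T : finType) (G : sgraph T),
      #|T| = n -> cycle_free 5 G -> induced_C4_free G ->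
      #|edges G|%:R <= (1 + o n) * (n%:R `^ (3 / 2) / (2 * 2 `^ (10^-1))).
Proof.
(* Beyond [10 ^+ 6] the gap between [2 * 2^(1/10)] and [sqrt 6] absorbs the error term; below it the
   trivial bound [n^2 / 2] suffices. *)
exists (fun n => if n%:R < 10 ^+ 6 :> R then 4 * n%:R ^+ 2 else 0); split.
  apply: cvg_near_cst; near=> n; rewrite ifF //; apply/negbTE; rewrite -leNgt.
  by near: n; exact: nbhs_infty_ger.
move=> n T G cardT C5 C4.
have := degsum_cube_le C5 C4; have := degsum_le G; have := edges_le_degsum G.
rewrite cardT; move: (degsum G) #|edges G| => d e.
move=> leE leN leD.
pose N : R := n%:R; pose D : R := d%:R; pose E : R := e%:R.
have hE : 2 * E <= D by rewrite -natrM ler_nat.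
have hN : D <= N ^+ 2 by rewrite -natrX ler_nat.
have hD : 3 * D ^+ 3 <= 2 * (D * N ^+ 3) + 308 * N ^+ 4.
  by rewrite -!natrX -!natrM -natrD ler_nat.
rewrite -/N -/E.
have [N0 D0 E0] : [/\ 0 <= N, 0 <= D & 0 <= E] by rewrite !ler0n.
set P := N `^ (3 / 2); set r : R := 2 `^ 10^-1.
have P0 : 0 <= P by exact: powR_ge0.
have P2 : P ^+ 2 = N ^+ 3.
  by rewrite -!powR_mulrn // /P -powRrM divfK.
have r0 : 0 < r by exact: powR_gt0.
have r10 : r ^+ 10 = 2.
  by rewrite -powR_mulrn ?ltW // /r -powRrM mulVf // powRr1.
(* [r ^+ 2] is the fifth root of 2, and [(5 / 4) ^+ 5 > 3]. *)
have r2 : r ^+ 2 <= 5 / 4.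
  rewrite -(@ler_pXn2r _ 5) ?nnegrE ?exprn_ge0 ?ltW //.
  by rewrite -exprM r10; lra.
have pr : 0 < 2 * r by rewrite mulr_gt0.
rewrite mulrA ler_pdivlMr //.
have [small|large] := ltrP N (10 ^+ 6).
  have rle : r <= 2 by nra.
  have [n0|n0] := posnP n; first by rewrite /N n0 in hN *; nra.
  have N1 : 1 <= N by rewrite ler1n.
  have P1 : 1 <= P.
    rewrite -(@ler_pXn2r _ 2) ?nnegrE // expr1n P2; exact: exprn_ege1.
  nra.
rewrite addr0 mul1r leNgt; apply/negP => lt.
(* A counterexample has [D ^+ 2 >= 4/5 N ^+ 3], above the threshold [2/3 N ^+ 3]
   beyond which [hD] bounds [D] by a multiple of [N]. *)
have lt' : P < D * r by nra.
have D2 : 4 / 5 * N ^+ 3 <= D ^+ 2.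
  have : P ^+ 2 <= (D * r) ^+ 2 by rewrite ler_pXn2r ?nnegrE // ?mulr_ge0 // ltW.
  by rewrite P2 exprMn; have := sqr_ge0 D; nra.
have Np : 0 < N by lra.
(* [3 * (4 / 5) - 2 = 4 / 10] and [308 / (4 / 10) = 770]. *)
have DN : D <= 770 * N.
  have : D * (4 / 10 * N ^+ 3) <= 308 * N * N ^+ 3.
    by have := ler_wpM2l D0 D2; nra.
  have N3 : 0 < N ^+ 3 by exact: exprn_gt0.
  by rewrite mulrA ler_pM2r //; lra.
(* This forces [N <= 741125], below the threshold [10 ^+ 6]. *)
have : 4 / 5 * N ^+ 3 <= 770 ^+ 2 * N ^+ 2.
  apply: le_trans D2 _; rewrite -exprMn ler_pXn2r ?nnegrE //; nra.
have -> : 4 / 5 * N ^+ 3 = (4 / 5 * N) * N ^+ 2 by ring.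
rewrite ler_pM2r ?exprn_gt0 //; lra.
Unshelve. all: by end_near.
Qed.
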